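(* The operads $\mathcal{DT}$, $\mathrm{ARef}$, $\mathbb H(\mathrm{RAS},\mathrm{RAS})$ and $\mathbb H(\mathrm{ARAS},\mathrm{ARAS})$ are isomorphic.
   Context: Operads: a (nonsymmetric, set) operad is a graded set $P=\bigsqcup_{n\geq1}P_n$ with maps $\circ_i:P_n\times P_m\to P_{n+m-1}$ ($1\leq i\leq n$) and a unit $\mathbf 1\in P_1$ such that for $p_1\in P_n,p_2\in P_m,p_3\in P_p$: $(p_1\circ_ip_2)\circ_{j+m-1}p_3=(p_1\circ_jp_3)\circ_ip_2$ for $1\leq i<j\leq n$; $(p_1\circ_ip_2)\circ_{i+j-1}p_3=p_1\circ_i(p_2\circ_jp_3)$ for $1\leq i\leq n$, $1\leq j\leq m$; $p_1\circ_i\mathbf 1=p_1=\mathbf 1\circ_1p_1$. Isomorphisms are arity-preserving bijections preserving unit and all partial compositions. The Hadamard product $\mathbb H(P,P')$ has as elements of arity $n$ the pairs $(p,p')\in P_n\times P'_n$, with $(p_1,p'_1)\circ_i(p_2,p'_2)=(p_1\circ_ip_2,p'_1\circ_i'p'_2)$. For $i\in\mathbb Z$, $n\geq1$ and a positive integer $x$, let $\sigma^{i,n}(x)=x$ if $x\leq i$ and $\sigma^{i,n}(x)=x+n-1$ otherwise; extend to pairs by $\sigma^{i,n}(x,y)=(\sigma^{i,n}(x),\sigma^{i,n}(y))$ and to sets of pairs elementwise. $\mathrm{ARef}$: elements of arity $n$ are the symbols $a_R^{(n)}$ with $R\subseteq\{(x,y):1\leq x,y\leq n+1,\ x\neq y\}$.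 $\mathrm{ARAS}$: elements of arity $n$ are the symbols $a_R^{(n)}$ with $R\subseteq\{(x,y):1\leq x<y\leq n+1\}$. In both, $a_R^{(n)}\circ_ia_{R'}^{(m)}=a^{(n+m-1)}_{\sigma^{i,m}(R)\cup\sigma^{0,i}(R')}$, with unit $a_\emptyset^{(1)}$. $\mathrm{RAS}$: elements of arity $n$ are the reflexive and antisymmetric relations $R$ on $\{1,\dots,n+1\}$ contained in the natural order $\leq$; $R\circ_iR'=\sigma^{i,m}(R)\cup\sigma^{0,i}(R')$ for $R\in \mathrm{RAS}_n$, $R'\in\mathrm{RAS}_m$. $\mathcal T$ (multi-tildes): elements of arity $n$ are the subsets $T$ of $\{(x,y):1\leq x\leq y\leq n\}$ (sets in different arities being regarded as different). Put $\rho^{i,n}(x,y)=(x,y)$ if $y<i$; $(x,y+n-1)$ if $x\leq i\leq y$; $(x+n-1,y+n-1)$ otherwise; extend elementwise to sets. Then $T_1\circ_iT_2=\rho^{i,m}(T_1)\cup\rho^{0,i}(T_2)$ for $T_1\in\mathcal T_n$, $T_2\in\mathcal T_m$, with unit $\emptyset\in\mathcal T_1$. $\mathcal{DT}:=\mathbb H(\mathcal T,\mathcal T)$ is the operad of double multi-tildes. *)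

(* Defs.v *)
From mathcomp Require Import all_boot finmap zify.

Set Implicit Arguments.
Unset Strict Implicit.
Unset Printing Implicit Defensive.

Local Open Scope fset_scope.
Local Open Scope nat_scope.

(* A nonsymmetric set operad is a family [op_el] whose n-th member is the set
   of elements of arity n; [op_gt0] says that there is none of arity 0.
   [op_comp i] is the partial composition at the i-th input, defined only for
   1 <= i <= n, inputs being numbered from 1 (the range is a boolean, so the
   value does not depend on its proof). The two sides of each axiom have arities
   that are equal but not convertible, hence they are compared as elements of
   the graded set {n & op_el n}. The ranges [hjm], [hip] and [hij] follow from
   the other hypotheses. *)
Record operad := Operad {
  op_el : nat -> Type;
  op_gt0 : forall n, op_el n -> 0 < n;
  op_unit : op_el 1;
  op_comp : forall n m (i : nat), 1 <= i <= n ->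
    op_el n -> op_el m -> op_el (n + m - 1);
  op_parallel : forall n m p (p1 : op_el n) (p2 : op_el m) (p3 : op_el p)
    (i j : nat) (hi : 1 <= i <= n) (hj : 1 <= j <= n)
    (hjm : 1 <= j + m - 1 <= n + m - 1) (hip : 1 <= i <= n + p - 1),
    i < j ->
    Tagged op_el (op_comp hjm (op_comp hi p1 p2) p3) =
    Tagged op_el (op_comp hip (op_comp hj p1 p3) p2);
  op_sequential : forall n m p (p1 : op_el n) (p2 : op_el m) (p3 : op_el p)
    (i j : nat) (hi : 1 <= i <= n) (hj : 1 <= j <= m)
    (hij : 1 <= i + j - 1 <= n + m - 1),
    Tagged op_el (op_comp hij (op_comp hi p1 p2) p3) =
    Tagged op_el (op_comp hi p1 (op_comp hj p2 p3));
  op_unitr : forall n (p1 : op_el n) (i : nat) (hi : 1 <= i <= n),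
    Tagged op_el (op_comp hi p1 op_unit) = Tagged op_el p1;
  op_unitl : forall n (p1 : op_el n) (h1 : 1 <= 1 <= 1),
    Tagged op_el (op_comp h1 op_unit p1) = Tagged op_el p1
}.

Definition operad_isomorphic (P Q : operad) : Prop :=
  exists f : forall n, op_el P n -> op_el Q n,
    [/\ forall n, bijective (f n),
        f 1 (op_unit P) = op_unit Q &
        forall n m (i : nat) (hi : 1 <= i <= n)
               (p : op_el P n) (q : op_el P m),
          f (n + m - 1) (op_comp hi p q) = op_comp hi (f n p) (f m q)].

Section Hadamard.
Variables P Q : operad.

Definition hadamard_el n : Type := (op_el P n * op_el Q n)%type.

Definition hadamard_comp n m (i : nat) (hi : 1 <= i <= n)
    (p : hadamard_el n) (q : hadamard_el m) : hadamard_el (n + m - 1) :=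
  (op_comp hi p.1 q.1, op_comp hi p.2 q.2).

Lemma hadamard_tagged n m (x : hadamard_el n) (y : hadamard_el m) :
  Tagged (op_el P) x.1 = Tagged (op_el P) y.1 ->
  Tagged (op_el Q) x.2 = Tagged (op_el Q) y.2 ->
  Tagged hadamard_el x = Tagged hadamard_el y.
Proof.
case: x y => x1 x2 [y1 y2] /= e1 e2.
have e : n = m by exact: (congr1 (@tag _ _) e1).
case: m / e y1 y2 e1 e2 => y1 y2 e1 e2.
have inj (F : nat -> Type) (a b : F n) : Tagged F a = Tagged F b -> a = b.
  move=> E; have := congr1 (tagged_as (Tagged F a)) E.
  by rewrite !tagged_asE.
by rewrite (inj _ _ _ e1) (inj _ _ _ e2).
Qed.

Definition hadamard : operad.
Proof.
refine (@Operad hadamard_el _ (op_unit P, op_unit Q) hadamard_comp _ _ _ _).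
- by move=> n [p _]; exact: op_gt0 p.
- by move=> *; apply: hadamard_tagged; apply: op_parallel.
- by move=> *; apply: hadamard_tagged; apply: op_sequential.
- by move=> *; apply: hadamard_tagged; apply: op_unitr.
- by move=> *; apply: hadamard_tagged; apply: op_unitl.
Defined.

End Hadamard.

(* The superscript i of sigma and rho is only ever an insertion position or 0,
   so it is taken in nat. Truncated subtraction is harmless, as n >= 1. *)
Definition sigma1 (i n x : nat) : nat := if x <= i then x else x + n - 1.

Definition sigma (i n : nat) (r : nat * nat) : nat * nat :=
  (sigma1 i n r.1, sigma1 i n r.2).

Definition rho (i n : nat) (r : nat * nat) : nat * nat :=
  if r.2 < i then r
  else if r.1 <= i <= r.2 then (r.1, r.2 + n - 1)
  else (r.1 + n - 1, r.2 + n - 1).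

Definition sigma_comp (i m : nat) (R R' : {fset nat * nat}) :
  {fset nat * nat} := sigma i m @` R `|` sigma 0 i @` R'.

Definition rho_comp (i m : nat) (T T' : {fset nat * nat}) :
  {fset nat * nat} := rho i m @` T `|` rho 0 i @` T'.

Definition in_square (k : nat) (r : nat * nat) : bool :=
  (1 <= r.1 <= k) && (1 <= r.2 <= k).

Definition is_ARef (n : nat) (R : {fset nat * nat}) : bool :=
  (0 < n) && all (fun r => in_square n.+1 r && (r.1 != r.2)) R.

Definition is_ARAS (n : nat) (R : {fset nat * nat}) : bool :=
  (0 < n) && all (fun r => in_square n.+1 r && (r.1 < r.2)) R.

Definition is_RAS (n : nat) (R : {fset nat * nat}) : bool :=
  [&& 0 < n,
      all (in_square n.+1) R,
      all (fun x => (x, x) \in R) (iota 1 n.+1),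
      all (fun r => ((r.2, r.1) \in R) ==> (r.1 == r.2)) R &
      all (fun r => r.1 <= r.2) R].

Definition is_MT (n : nat) (T : {fset nat * nat}) : bool :=
  (0 < n) && all (fun r => in_square n r && (r.1 <= r.2)) T.

(* The symbol a_R^(n) is represented by R seen as an element of arity n. *)
Definition ARef_el (n : nat) : Type := {R : {fset nat * nat} | is_ARef n R}.
Definition ARAS_el (n : nat) : Type := {R : {fset nat * nat} | is_ARAS n R}.
Definition RAS_el (n : nat) : Type := {R : {fset nat * nat} | is_RAS n R}.
Definition MT_el (n : nat) : Type := {T : {fset nat * nat} | is_MT n T}.

Lemma sub_tagged (P : nat -> pred {fset nat * nat}) n m
    (x : {R | P n R}) (y : {R | P m R}) :
  n = m -> val x = val y ->
  Tagged (fun k => {R | P k R}) x = Tagged (fun k => {R | P k R}) y.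
Proof. by move=> e; case: m / e y => y /val_inj ->. Qed.

Lemma sigma_comp_parallel n m p (R1 R2 R3 : {fset nat * nat}) i j :
  all (in_square n.+1) R1 -> all (in_square m.+1) R2 ->
  all (in_square p.+1) R3 -> 0 < m -> 0 < p -> 1 <= i -> i < j ->
  sigma_comp (j + m - 1) p (sigma_comp i m R1 R2) R3 =
  sigma_comp i m (sigma_comp j p R1 R3) R2.
Proof.
move=> /allP b1 /allP b2 /allP b3 m0 p0 i0 ij.
rewrite /sigma_comp !imfsetU -!imfset_comp -!fsetUA; congr (_ `|` _).
  apply: eq_in_imfset => // -[x y] /b1; rewrite /in_square /sigma /sigma1 /=.
  by move=> b; congr (_, _); repeat case: ifP; lia.
rewrite fsetUC; congr (_ `|` _).
  apply: eq_in_imfset => // -[x y] /b3; rewrite /in_square /sigma /sigma1 /=.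
  by move=> b; congr (_, _); repeat case: ifP; lia.
apply: eq_in_imfset => // -[x y] /b2; rewrite /in_square /sigma /sigma1 /=.
by move=> b; congr (_, _); repeat case: ifP; lia.
Qed.

Lemma sigma_comp_sequential n m p (R1 R2 R3 : {fset nat * nat}) i j :
  all (in_square n.+1) R1 -> all (in_square m.+1) R2 ->
  all (in_square p.+1) R3 -> 0 < p -> 1 <= i -> 1 <= j <= m ->
  sigma_comp (i + j - 1) p (sigma_comp i m R1 R2) R3 =
  sigma_comp i (m + p - 1) R1 (sigma_comp j p R2 R3).
Proof.
move=> /allP b1 /allP b2 /allP b3 p0 i0 j0.
rewrite /sigma_comp !imfsetU -!imfset_comp -!fsetUA; congr (_ `|` _).
  apply: eq_in_imfset => // -[x y] /b1; rewrite /in_square /sigma /sigma1 /=.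
  by move=> b; congr (_, _); repeat case: ifP; lia.
congr (_ `|` _).
  apply: eq_in_imfset => // -[x y] /b2; rewrite /in_square /sigma /sigma1 /=.
  by move=> b; congr (_, _); repeat case: ifP; lia.
apply: eq_in_imfset => // -[x y] /b3; rewrite /in_square /sigma /sigma1 /=.
by move=> b; congr (_, _); repeat case: ifP; lia.
Qed.

Lemma sigma_1 i (R : {fset nat * nat}) : sigma i 1 @` R = R.
Proof.
rewrite -[RHS]imfset_id; apply: eq_in_imfset => // -[x y] _.
by rewrite /sigma /sigma1 /=; congr (_, _); case: ifP; lia.
Qed.

Lemma sigma_comp0r i (R : {fset nat * nat}) : sigma_comp i 1 R fset0 = R.
Proof. by rewrite /sigma_comp imfset0 fsetU0 sigma_1. Qed.

Lemma sigma_comp0l m (R : {fset nat * nat}) : sigma_comp 1 m fset0 R = R.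
Proof. by rewrite /sigma_comp imfset0 fset0U sigma_1. Qed.

Lemma rho_le i n r : r.1 <= r.2 ->
  rho i n r = (sigma1 i n r.1, if r.2 < i then r.2 else r.2 + n - 1).
Proof.
by case: r => x y /= xy; rewrite /rho /sigma1 /=; do ?[case: ifP => /= ?];
   congr (_, _); lia.
Qed.

Lemma rho_comp_parallel n m p (T1 T2 T3 : {fset nat * nat}) i j :
  is_MT n T1 -> is_MT m T2 -> is_MT p T3 -> 1 <= i -> i < j ->
  rho_comp (j + m - 1) p (rho_comp i m T1 T2) T3 =
  rho_comp i m (rho_comp j p T1 T3) T2.
Proof.
move=> /andP[n0 /allP b1] /andP[m0 /allP b2] /andP[p0 /allP b3] i0 ij.
rewrite /rho_comp !imfsetU -!imfset_comp -!fsetUA; congr (_ `|` _).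
  apply: eq_in_imfset => // -[x y] /b1 /andP[b] /= xy.
  by rewrite !rho_le /sigma1 /= ?xy //; move: b; rewrite /in_square /=;
     move=> b; try congr (_, _); repeat case: ifP; lia.
rewrite fsetUC; congr (_ `|` _).
  apply: eq_in_imfset => // -[x y] /b3 /andP[b] /= xy.
  by rewrite !rho_le /sigma1 /= ?xy //; move: b; rewrite /in_square /=;
     move=> b; try congr (_, _); repeat case: ifP; lia.
apply: eq_in_imfset => // -[x y] /b2 /andP[b] /= xy.
by rewrite !rho_le /sigma1 /= ?xy //; move: b; rewrite /in_square /=;
     move=> b; try congr (_, _); repeat case: ifP; lia.
Qed.

Lemma rho_comp_sequential n m p (T1 T2 T3 : {fset nat * nat}) i j :
  is_MT n T1 -> is_MT m T2 -> is_MT p T3 -> 1 <= i -> 1 <= j <= m ->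
  rho_comp (i + j - 1) p (rho_comp i m T1 T2) T3 =
  rho_comp i (m + p - 1) T1 (rho_comp j p T2 T3).
Proof.
move=> /andP[n0 /allP b1] /andP[m0 /allP b2] /andP[p0 /allP b3] i0 j0.
rewrite /rho_comp !imfsetU -!imfset_comp -!fsetUA; congr (_ `|` _).
  apply: eq_in_imfset => // -[x y] /b1 /andP[b] /= xy.
  by rewrite !rho_le /sigma1 /= ?xy //; move: b; rewrite /in_square /=;
     move=> b; try congr (_, _); repeat case: ifP; lia.
congr (_ `|` _).
  apply: eq_in_imfset => // -[x y] /b2 /andP[b] /= xy.
  by rewrite !rho_le /sigma1 /= ?xy //; move: b; rewrite /in_square /=;
     move=> b; try congr (_, _); repeat case: ifP; lia.
apply: eq_in_imfset => // -[x y] /b3 /andP[b] /= xy.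
by rewrite !rho_le /sigma1 /= ?xy //; move: b; rewrite /in_square /=;
     move=> b; try congr (_, _); repeat case: ifP; lia.
Qed.

Lemma rho_1 i (T : {fset nat * nat}) : rho i 1 @` T = T.
Proof.
rewrite -[RHS]imfset_id; apply: eq_in_imfset => // -[x y] _.
by rewrite /rho /=; do ?[case: ifP => /= ?]; congr (_, _); lia.
Qed.

Lemma ARef_square n (R : ARef_el n) : all (in_square n.+1) (val R).
Proof.
by case: R => R /= /andP[_ /allP h]; apply/allP => r /h /andP[].
Qed.

Lemma ARAS_square n (R : ARAS_el n) : all (in_square n.+1) (val R).
Proof.
by case: R => R /= /andP[_ /allP h]; apply/allP => r /h /andP[].
Qed.

Lemma RAS_square n (R : RAS_el n) : all (in_square n.+1) (val R).
Proof. by case: R => R /= /and5P[]. Qed.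

Lemma ARef_gt0 n : ARef_el n -> 0 < n.
Proof. by case=> R /andP[]. Qed.

Lemma ARAS_gt0 n : ARAS_el n -> 0 < n.
Proof. by case=> R /andP[]. Qed.

Lemma RAS_gt0 n : RAS_el n -> 0 < n.
Proof. by case=> R /and5P[]. Qed.

Lemma MT_gt0 n : MT_el n -> 0 < n.
Proof. by case=> R /andP[]. Qed.

Lemma is_ARef_comp n m i (R R' : {fset nat * nat}) :
  1 <= i <= n -> is_ARef n R -> is_ARef m R' ->
  is_ARef (n + m - 1) (sigma_comp i m R R').
Proof.
move=> hi /andP[n0 /allP b] /andP[m0 /allP b']; apply/andP; split; first lia.
apply/allP => r /fsetUP[] /imfsetP[[x y] /= xy ->].
  have := b _ xy; rewrite /in_square /sigma /sigma1 /=.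
  by do ?[case: ifP => /= ?]; lia.
have := b' _ xy; rewrite /in_square /sigma /sigma1 /=.
by do ?[case: ifP => /= ?]; lia.
Qed.

Lemma is_ARAS_comp n m i (R R' : {fset nat * nat}) :
  1 <= i <= n -> is_ARAS n R -> is_ARAS m R' ->
  is_ARAS (n + m - 1) (sigma_comp i m R R').
Proof.
move=> hi /andP[n0 /allP b] /andP[m0 /allP b']; apply/andP; split; first lia.
apply/allP => r /fsetUP[] /imfsetP[[x y] /= xy ->].
  have := b _ xy; rewrite /in_square /sigma /sigma1 /=.
  by do ?[case: ifP => /= ?]; lia.
have := b' _ xy; rewrite /in_square /sigma /sigma1 /=.
by do ?[case: ifP => /= ?]; lia.
Qed.

Lemma is_MT_comp n m i (T T' : {fset nat * nat}) :
  1 <= i <= n -> is_MT n T -> is_MT m T' ->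
  is_MT (n + m - 1) (rho_comp i m T T').
Proof.
move=> hi /andP[n0 /allP b] /andP[m0 /allP b']; apply/andP; split; first lia.
apply/allP => r /fsetUP[] /imfsetP[[x y] /= xy ->].
  have := b _ xy; rewrite /in_square /rho /=.
  by do ?[case: ifP => /= ?]; lia.
have := b' _ xy; rewrite /in_square /rho /=.
by do ?[case: ifP => /= ?]; lia.
Qed.

Lemma is_RAS_comp n m i (R R' : {fset nat * nat}) :
  1 <= i <= n -> is_RAS n R -> is_RAS m R' ->
  is_RAS (n + m - 1) (sigma_comp i m R R').
Proof.
move=> hi /and5P[n0 /allP b /allP rf _ /allP l].
move=> /and5P[m0 /allP b' /allP rf' _ /allP l'].
have L r : r \in sigma_comp i m R R' -> r.1 <= r.2.
  move=> /fsetUP[] /imfsetP[[x y] /= xy ->].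
    have := l _ xy; rewrite /sigma /sigma1 /=.
    by do ?[case: ifP => /= ?]; lia.
  have := l' _ xy; rewrite /sigma /sigma1 /=.
  by do ?[case: ifP => /= ?]; lia.
apply/and5P; split; first lia.
- apply/allP => r /fsetUP[] /imfsetP[[x y] /= xy ->].
    have := b _ xy; rewrite /in_square /sigma /sigma1 /=.
    by do ?[case: ifP => /= ?]; lia.
  have := b' _ xy; rewrite /in_square /sigma /sigma1 /=.
  by do ?[case: ifP => /= ?]; lia.
- apply/allP => x; rewrite mem_iota => hx; apply/fsetUP.
  have [xi|ix] := leqP x i.
    left; apply/imfsetP; exists (x, x) => /=.
      by apply: rf; rewrite mem_iota; lia.
    by rewrite /sigma /sigma1 /= xi.
  have [xm|mx] := leqP x (i + m).
    right; apply/imfsetP; exists (x - i + 1, x - i + 1) => /=.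
      by apply: rf'; rewrite mem_iota; lia.
    by rewrite /sigma /sigma1 /=; case: ifP => /= ?; congr (_, _); lia.
  left; apply/imfsetP; exists (x - m + 1, x - m + 1) => /=.
    by apply: rf; rewrite mem_iota; lia.
  by rewrite /sigma /sigma1 /=; case: ifP => /= ?; congr (_, _); lia.
- apply/allP => -[x y] xy /=; apply/implyP => yx.
  by rewrite eqn_leq (L _ xy) (L _ yx).
- exact/allP.
Qed.

Definition ARef_comp n m (i : nat) (hi : 1 <= i <= n)
    (R : ARef_el n) (R' : ARef_el m) : ARef_el (n + m - 1) :=
  exist _ (sigma_comp i m (val R) (val R'))
    (is_ARef_comp hi (valP R) (valP R')).

Definition ARAS_comp n m (i : nat) (hi : 1 <= i <= n)
    (R : ARAS_el n) (R' : ARAS_el m) : ARAS_el (n + m - 1) :=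
  exist _ (sigma_comp i m (val R) (val R'))
    (is_ARAS_comp hi (valP R) (valP R')).

Definition RAS_comp n m (i : nat) (hi : 1 <= i <= n)
    (R : RAS_el n) (R' : RAS_el m) : RAS_el (n + m - 1) :=
  exist _ (sigma_comp i m (val R) (val R'))
    (is_RAS_comp hi (valP R) (valP R')).

Definition MT_comp n m (i : nat) (hi : 1 <= i <= n)
    (T : MT_el n) (T' : MT_el m) : MT_el (n + m - 1) :=
  exist _ (rho_comp i m (val T) (val T'))
    (is_MT_comp hi (valP T) (valP T')).

Lemma is_ARef_unit : is_ARef 1 fset0.
Proof. by apply/andP; split=> //; apply/allP => r; rewrite in_fset0. Qed.

Lemma is_ARAS_unit : is_ARAS 1 fset0.
Proof. by apply/andP; split=> //; apply/allP => r; rewrite in_fset0. Qed.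

Lemma is_MT_unit : is_MT 1 fset0.
Proof. by apply/andP; split=> //; apply/allP => r; rewrite in_fset0. Qed.

Lemma is_RAS_unit : is_RAS 1 [fset (1, 1); (2, 2)].
Proof.
apply/and5P; split=> //.
- by apply/allP => r; rewrite !inE => /orP[] /eqP ->.
- by rewrite /= !inE !eqxx orbT.
- by apply/allP => r; rewrite !inE => /orP[] /eqP ->; rewrite implybT.
- by apply/allP => r; rewrite !inE => /orP[] /eqP ->.
Qed.

Definition ARef : operad.
Proof.
refine (@Operad ARef_el ARef_gt0 (exist _ fset0 is_ARef_unit) ARef_comp
          _ _ _ _).
- move=> n m p p1 p2 p3 i j hi hj hjm hip ij.
  have [? ?] := (ARef_gt0 p2, ARef_gt0 p3).
  apply: (@sub_tagged is_ARef); first lia.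
  by apply: (sigma_comp_parallel (ARef_square p1) (ARef_square p2)
                                 (ARef_square p3)); lia.
- move=> n m p p1 p2 p3 i j hi hj hij.
  have [? ?] := (ARef_gt0 p2, ARef_gt0 p3).
  apply: (@sub_tagged is_ARef); first lia.
  by apply: (sigma_comp_sequential (ARef_square p1) (ARef_square p2)
                                   (ARef_square p3)); lia.
- move=> n p1 i hi; apply: (@sub_tagged is_ARef); first lia.
  exact: sigma_comp0r.
- move=> n p1 h1; apply: (@sub_tagged is_ARef); first lia.
  exact: sigma_comp0l.
Defined.

Definition ARAS : operad.
Proof.
refine (@Operad ARAS_el ARAS_gt0 (exist _ fset0 is_ARAS_unit) ARAS_comp
          _ _ _ _).
- move=> n m p p1 p2 p3 i j hi hj hjm hip ij.
  have [? ?] := (ARAS_gt0 p2, ARAS_gt0 p3).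
  apply: (@sub_tagged is_ARAS); first lia.
  by apply: (sigma_comp_parallel (ARAS_square p1) (ARAS_square p2)
                                 (ARAS_square p3)); lia.
- move=> n m p p1 p2 p3 i j hi hj hij.
  have [? ?] := (ARAS_gt0 p2, ARAS_gt0 p3).
  apply: (@sub_tagged is_ARAS); first lia.
  by apply: (sigma_comp_sequential (ARAS_square p1) (ARAS_square p2)
                                   (ARAS_square p3)); lia.
- move=> n p1 i hi; apply: (@sub_tagged is_ARAS); first lia.
  exact: sigma_comp0r.
- move=> n p1 h1; apply: (@sub_tagged is_ARAS); first lia.
  exact: sigma_comp0l.
Defined.

(* The unit is the only possible one: the equality relation on {1, 2}. *)
Definition RAS : operad.
Proof.
refine (@Operad RAS_el RAS_gt0
          (exist _ [fset (1, 1); (2, 2)] is_RAS_unit) RAS_comp _ _ _ _).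
- move=> n m p p1 p2 p3 i j hi hj hjm hip ij.
  have [? ?] := (RAS_gt0 p2, RAS_gt0 p3).
  apply: (@sub_tagged is_RAS); first lia.
  by apply: (sigma_comp_parallel (RAS_square p1) (RAS_square p2)
                                 (RAS_square p3)); lia.
- move=> n m p p1 p2 p3 i j hi hj hij.
  have [? ?] := (RAS_gt0 p2, RAS_gt0 p3).
  apply: (@sub_tagged is_RAS); first lia.
  by apply: (sigma_comp_sequential (RAS_square p1) (RAS_square p2)
                                   (RAS_square p3)); lia.
- move=> n p1 i hi; apply: (@sub_tagged is_RAS); first lia.
  case: p1 => R /= /and5P[_ _ /allP rf _ _].
  rewrite /sigma_comp sigma_1; apply/fsetUidPl/fsubsetP => r /imfsetP[s /=].
  rewrite !inE => /orP[] /eqP -> ->; rewrite /sigma /sigma1 /=; apply: rf.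
    by rewrite mem_iota; lia.
  by rewrite mem_iota; lia.
- move=> n p1 h1; apply: (@sub_tagged is_RAS); first lia.
  case: p1 => R /= /and5P[n0 _ /allP rf _ _].
  rewrite /sigma_comp sigma_1; apply/fsetUidPr/fsubsetP => r /imfsetP[s /=].
  rewrite !inE => /orP[] /eqP -> ->; rewrite /sigma /sigma1 /=; apply: rf.
    by rewrite mem_iota; lia.
  by rewrite mem_iota; lia.
Defined.

Definition MT : operad.
Proof.
refine (@Operad MT_el MT_gt0 (exist _ fset0 is_MT_unit) MT_comp _ _ _ _).
- move=> n m p p1 p2 p3 i j hi hj hjm hip ij.
  have [? ?] := (MT_gt0 p2, MT_gt0 p3).
  apply: (@sub_tagged is_MT); first lia.
  by apply: (rho_comp_parallel (valP p1) (valP p2) (valP p3)); lia.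
- move=> n m p p1 p2 p3 i j hi hj hij.
  have [? ?] := (MT_gt0 p2, MT_gt0 p3).
  apply: (@sub_tagged is_MT); first lia.
  by apply: (rho_comp_sequential (valP p1) (valP p2) (valP p3)); lia.
- move=> n p1 i hi; apply: (@sub_tagged is_MT); first lia.
  by rewrite /= /rho_comp imfset0 fsetU0 rho_1.
- move=> n p1 h1; apply: (@sub_tagged is_MT); first lia.
  by rewrite /= /rho_comp imfset0 fset0U rho_1.
Defined.

Definition DT : operad := hadamard MT MT.

(* Main.v *)
From mathcomp Require Import all_boot finmap zify.
Require Import Defs.

(** The map (x, y) |-> (x, y + 1) turns rho into sigma, so T is isomorphic to
    ARAS. Deleting the diagonal, which commutes with sigma because sigma^{i,m}
    is injective, identifies RAS with ARAS. Finally a relation in ARef is the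
    disjoint union of its part above the diagonal and its part below, which is
    the converse of a relation above the diagonal; sigma commutes with the
    converse, so ARef is isomorphic to H(ARAS, ARAS). *)

Set Implicit Arguments.
Unset Strict Implicit.
Unset Printing Implicit Defensive.

Local Open Scope fset_scope.
Local Open Scope nat_scope.

(* Unlike in [operad_isomorphic], the inverse is a single function of the
   arity, so that symmetry does not need the axiom of choice. *)
Definition operad_equiv (P Q : operad) : Prop :=
  exists (f : forall n, op_el P n -> op_el Q n)
         (g : forall n, op_el Q n -> op_el P n),
    [/\ forall n, cancel (f n) (g n),
        forall n, cancel (g n) (f n),
        f 1 (op_unit P) = op_unit Q &
        forall n m (i : nat) (hi : 1 <= i <= n)
               (p : op_el P n) (q : op_el P m),
          f (n + m - 1) (op_comp hi p q) = op_comp hi (f n p) (f m q)].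

Lemma operad_equiv_isomorphic P Q : operad_equiv P Q -> operad_isomorphic P Q.
Proof. by case=> f [g [fK gK f1 fM]]; exists f; split=> // n; exists (g n). Qed.

Lemma operad_equiv_sym P Q : operad_equiv P Q -> operad_equiv Q P.
Proof.
case=> f [g [fK gK f1 fM]]; exists g, f; split=> // [|n m i hi p q].
  by rewrite -f1 fK.
by apply: (can_inj (fK _)); rewrite fM !gK.
Qed.

Lemma operad_equiv_trans P Q R :
  operad_equiv P Q -> operad_equiv Q R -> operad_equiv P R.
Proof.
case=> f [f' [fK f'K f1 fM]] [g [g' [gK g'K g1 gM]]].
exists (fun n => g n \o f n), (fun n => f' n \o g' n).
split=> [n|n||n m i hi p q].
- exact: can_comp (gK n) (fK n).
- exact: can_comp (f'K n) (g'K n).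
- by rewrite /= f1 g1.
- by rewrite /= fM gM.
Qed.

Lemma hadamard_equiv P P' Q Q' :
  operad_equiv P P' -> operad_equiv Q Q' ->
  operad_equiv (hadamard P Q) (hadamard P' Q').
Proof.
case=> f [f' [fK f'K f1 fM]] [g [g' [gK g'K g1 gM]]].
exists (fun n x => (f n x.1, g n x.2)), (fun n x => (f' n x.1, g' n x.2)).
split=> [n x|n x||n m i hi p q] /=.
- by rewrite fK gK; case: x.
- by rewrite f'K g'K; case: x.
- by rewrite f1 g1.
- by rewrite fM gM.
Qed.

(** * Images of finite sets and injectivity of the shifts *)

(** Cancellation is asked on [A] only, because [raise] undoes [lower] only where the second
    coordinate is positive. *)
Lemma imfset_can_in (T : choiceType) (A : {fset T}) (h k : T -> T) :
  {in A, cancel h k} -> k @` (h @` A) = A.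
Proof.
by move=> hK; rewrite -imfset_comp -[RHS]imfset_id; apply: eq_in_imfset.
Qed.

Lemma imfset_filter (T : choiceType) (A : {fset T}) (h : T -> T) (p : pred T) :
  (forall x, p (h x) = p x) ->
  [fset r in h @` A | p r] = h @` [fset r in A | p r].
Proof.
move=> ph; apply/fsetP => y; rewrite !inE; apply/andP/imfsetP => /=.
  case=> /imfsetP[x /= xA ->]; rewrite ph => px.
  by exists x; rewrite // !inE xA.
case=> x; rewrite !inE => /andP[xA px] ->; split; last by rewrite ph.
by apply/imfsetP; exists x.
Qed.

(** With [0 < m] the shifted points stay above [i]; for [m = 0] the point [i + 1] would land on
    [i]. *)
Lemma sigma1_inj i m : 0 < m -> injective (sigma1 i m).
Proof. by move=> m0 x y; rewrite /sigma1; do 2?[case: ifP]; lia. Qed.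

(** * From multi-tildes to [ARAS] *)

(** Reading [(x, y)] as the block of inputs [x] to [y], [raise] records its two boundary points
    among the [n + 1] around [n] inputs. *)
Definition raise (r : nat * nat) := (r.1, r.2.+1).
Definition lower (r : nat * nat) := (r.1, r.2.-1).

Lemma is_ARAS_raise n T : is_MT n T -> is_ARAS n (raise @` T).
Proof.
case/andP=> n0 /allP h; rewrite /is_ARAS n0; apply/allP => r.
by case/imfsetP=> -[x y] /= /h xy ->; move: xy; rewrite /in_square /=; lia.
Qed.

Lemma is_MT_lower n R : is_ARAS n R -> is_MT n (lower @` R).
Proof.
case/andP=> n0 /allP h; rewrite /is_MT n0; apply/allP => r.
by case/imfsetP=> -[x y] /= /h xy ->; move: xy; rewrite /in_square /=; lia.
Qed.

(** When [x <= y], [rho] shifts [x] iff [x > i] and [y] iff [y >= i]. The latter says [y + 1 > i],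
    the test that [sigma] makes on the raised coordinate. *)
Lemma raise_rho_comp n m i T T' : is_MT n T -> is_MT m T' -> 0 < i ->
  raise @` rho_comp i m T T' = sigma_comp i m (raise @` T) (raise @` T').
Proof.
case/andP=> n0 /allP h /andP[m0 /allP h'] i0.
rewrite /rho_comp /sigma_comp imfsetU -!imfset_comp; congr (_ `|` _).
all: apply: eq_in_imfset => // -[x y] /=.
- move/h; rewrite /in_square /= => b.
  rewrite rho_le /raise /sigma /sigma1 /=; last lia.
  by congr (_, _); repeat case: ifP; lia.
- move/h'; rewrite /in_square /= => b.
  rewrite rho_le /raise /sigma /sigma1 /=; last lia.
  by congr (_, _); repeat case: ifP; lia.
Qed.

Lemma MT_equiv_ARAS : operad_equiv MT ARAS.
Proof.
exists (fun n (T : MT_el n) =>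
  exist (is_ARAS n) _ (is_ARAS_raise (valP T)) : ARAS_el n).
exists (fun n (R : ARAS_el n) =>
  exist (is_MT n) _ (is_MT_lower (valP R)) : MT_el n).
split=> [n [T hT]|n [R hR]||n m i hi [T hT] [T' hT']]; apply: val_inj => /=.
- by apply: imfset_can_in => -[].
- apply: imfset_can_in => -[x y] xy; rewrite /raise /lower /=.
  (* Here [x < y], so [y] is positive and its predecessor does not truncate. *)
  by case/andP: hR => _ /allP/(_ _ xy) /=; case: y {xy} => //=; lia.
- exact: imfset0.
- by apply: raise_rho_comp hT hT' _; case/andP: hi.
Qed.

(** * Removing and restoring the diagonal *)

Definition offdiag (R : {fset nat * nat}) := [fset r in R | r.1 != r.2].
Definition diag n : {fset nat * nat} :=
  [fset r in map (fun x => (x, x)) (iota 1 n)].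

Lemma mem_offdiag R r : (r \in offdiag R) = (r \in R) && (r.1 != r.2).
Proof. by rewrite !inE. Qed.

Lemma mem_diag n r : (r \in diag n) = (1 <= r.1 <= n) && (r.1 == r.2).
Proof.
case: r => x y; rewrite !inE /=; apply/mapP/andP => /= [[z + [-> ->]]|].
  by rewrite mem_iota eqxx; split=> //; lia.
by case=> h /eqP <-; exists x; rewrite // mem_iota; lia.
Qed.

Lemma is_ARAS_offdiag n R : is_RAS n R -> is_ARAS n (offdiag R).
Proof.
case/and5P=> n0 /allP sq _ _ /allP le; rewrite /is_ARAS n0; apply/allP => r.
by rewrite !inE => /andP[rR ne]; rewrite sq //= ltn_neqAle ne le.
Qed.

Lemma is_RAS_diag n R : is_ARAS n R -> is_RAS n (R `|` diag n.+1).
Proof.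
case/andP=> n0 /allP h.
(* Containment in the natural order comes first, since it also yields antisymmetry. *)
have le r : r \in R `|` diag n.+1 -> in_square n.+1 r && (r.1 <= r.2).
  by case: r => x y; case/fsetUP=> [/h|]; rewrite ?mem_diag /in_square /=; lia.
apply/and5P; split=> //; apply/allP.
- by move=> r /le /andP[].
- by move=> x; rewrite mem_iota inE mem_diag /= => ?; apply/orP; right; lia.
- move=> r rR; apply/implyP => /le; have := le _ rR; rewrite /=; lia.
- by move=> r /le /andP[].
Qed.

Lemma offdiag_sigma i m (R : {fset nat * nat}) : 0 < m ->
  offdiag (sigma i m @` R) = sigma i m @` offdiag R.
Proof.
move=> m0; apply: imfset_filter => r.
by rewrite /= (inj_eq (sigma1_inj m0)).
Qed.

Lemma offdiagU (R R' : {fset nat * nat}) :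
  offdiag (R `|` R') = offdiag R `|` offdiag R'.
Proof. by apply/fsetP => r; rewrite !inE andb_orl. Qed.

Lemma RAS_equiv_ARAS : operad_equiv RAS ARAS.
Proof.
exists (fun n (R : RAS_el n) =>
  exist (is_ARAS n) _ (is_ARAS_offdiag (valP R)) : ARAS_el n).
exists (fun n (R : ARAS_el n) =>
  exist (is_RAS n) _ (is_RAS_diag (valP R)) : RAS_el n).
split=> [n [R hR]|n [R hR]||n m i hi [R hR] [R' hR']]; apply: val_inj => /=.
- case/and5P: hR => n0 /allP sq /allP rf _ _; apply/fsetP => -[x y].
  (* Off the diagonal nothing changes; on it, reflexivity of [R] gives one inclusion and the bounds
     on [R] the other. *)
  rewrite in_fsetU mem_diag mem_offdiag /=; case: eqVneq => [<-|] /=; last first.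
    by rewrite andbT andbF orbF.
  rewrite andbF andbT /=; apply/idP/idP => [h|/sq]; last by case/andP.
  by apply: rf; rewrite mem_iota; lia.
- case/andP: hR => n0 /allP h; apply/fsetP => r.
  rewrite mem_offdiag in_fsetU mem_diag.
  by have := h r; case: (r \in R) => //= [/(_ isT)|]; lia.
- apply/fsetP => r; rewrite mem_offdiag in_fset0.
  by apply/negP; rewrite !inE => /andP[/orP[] /eqP ->].
- have [m0 _] := andP hR'.
  have i0 : 0 < i by case/andP: hi.
  by rewrite offdiagU !offdiag_sigma.
Qed.

(** * Splitting a relation along the diagonal *)

Definition conv (R : {fset nat * nat}) : {fset nat * nat} :=
  [fset (r.2, r.1) | r in R].

Lemma mem_conv R r : (r \in conv R) = ((r.2, r.1) \in R).
Proof.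
apply/imfsetP/idP => /= [[s sR ->]|rR]; first by rewrite -surjective_pairing.
by exists (r.2, r.1) => //; case: r {rR}.
Qed.

(** Both coordinates undergo the same [sigma1], so swapping them before or after agrees by
    computation. *)
Lemma conv_sigma_comp i m R R' :
  conv (sigma_comp i m R R') = sigma_comp i m (conv R) (conv R').
Proof. by rewrite /conv /sigma_comp imfsetU -!imfset_comp. Qed.

(** Composition does not mix the two halves of a relation, which makes joining them a morphism. *)
Lemma sigma_compUU i m A A' B B' :
  sigma_comp i m (A `|` B) (A' `|` B') =
  sigma_comp i m A A' `|` sigma_comp i m B B'.
Proof. by rewrite /sigma_comp !imfsetU fsetUACA. Qed.

Definition above (R : {fset nat * nat}) := [fset r in R | r.1 < r.2].

Lemma is_ARef_conv n R : is_ARef n R -> is_ARef n (conv R).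
Proof.
case/andP=> n0 /allP h; rewrite /is_ARef n0; apply/allP => r.
by rewrite mem_conv => /h; rewrite /in_square /=; lia.
Qed.

Lemma is_ARAS_above n R : is_ARef n R -> is_ARAS n (above R).
Proof.
case/andP=> n0 /allP h; rewrite /is_ARAS n0; apply/allP => r.
by rewrite !inE => /andP[/h /andP[-> _] ->].
Qed.

Lemma is_ARef_join n A B :
  is_ARAS n A -> is_ARAS n B -> is_ARef n (A `|` conv B).
Proof.
case/andP=> n0 /allP hA /andP[_ /allP hB]; rewrite /is_ARef n0; apply/allP => r.
by rewrite inE mem_conv => /orP[/hA|/hB]; rewrite /in_square /=; lia.
Qed.

(** Pairs of [conv B] are decreasing, so the filter discards all of them. *)
Lemma above_join n A B : is_ARAS n A -> is_ARAS n B -> above (A `|` conv B) = A.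
Proof.
case/andP=> n0 /allP hA /andP[_ /allP hB]; apply/fsetP => r.
rewrite /above !inE mem_conv; have := hA r; have := hB (r.2, r.1).
case: (r \in A) => [_ /(_ isT)|]; first by case/andP.
by case: (_ \in B) => //= /(_ isT); lia.
Qed.

(** Recovering [B] thus reduces to [above_join] with [A] and [B] exchanged. *)
Lemma conv_join A B : conv (A `|` conv B) = B `|` conv A.
Proof.
by apply/fsetP => -[x y]; rewrite mem_conv !inE !mem_conv orbC.
Qed.

(** By irreflexivity, each pair of [R] is either increasing or the swap of an increasing one. *)
Lemma join_above n R : is_ARef n R -> above R `|` conv (above (conv R)) = R.
Proof.
case/andP=> n0 /allP h; apply/fsetP => -[x y].
rewrite inE mem_conv !inE mem_conv /=; have := h (x, y).
by case: (_ \in R) => //= /(_ isT) /=; lia.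
Qed.

Lemma hadamard_ARAS_equiv_ARef : operad_equiv (hadamard ARAS ARAS) ARef.
Proof.
exists (fun n (R : ARAS_el n * ARAS_el n) =>
  exist (is_ARef n) _ (is_ARef_join (valP R.1) (valP R.2)) : ARef_el n).
exists (fun n (R : ARef_el n) =>
  (exist (is_ARAS n) _ (is_ARAS_above (valP R)),
   exist (is_ARAS n) _ (is_ARAS_above (is_ARef_conv (valP R)))) : ARAS_el n * ARAS_el n).
split=> [n [[A hA] [B hB]]|n [R hR]||
         n m i hi [[A hA] [B hB]] [[A' hA'] [B' hB']]].
- congr (_, _); apply: val_inj => /=; first exact: above_join hA hB.
  by rewrite conv_join; apply: above_join hB hA.
- by apply: val_inj; apply: join_above hR.
- by apply: val_inj; rewrite /= /conv imfset0 fsetU0.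
- by apply: val_inj; rewrite /= conv_sigma_comp sigma_compUU.
Qed.

Theorem corollary1 :
  operad_isomorphic DT ARef /\
  operad_isomorphic DT (hadamard RAS RAS) /\
  operad_isomorphic DT (hadamard ARAS ARAS) /\
  operad_isomorphic ARef (hadamard RAS RAS) /\
  operad_isomorphic ARef (hadamard ARAS ARAS) /\
  operad_isomorphic (hadamard RAS RAS) (hadamard ARAS ARAS).
Proof.
have DT_ARAS := hadamard_equiv MT_equiv_ARAS MT_equiv_ARAS.
have RAS_ARAS := hadamard_equiv RAS_equiv_ARAS RAS_equiv_ARAS.
have ARAS_RAS := operad_equiv_sym RAS_ARAS.
have ARAS_ARef := hadamard_ARAS_equiv_ARef.
have ARef_ARAS := operad_equiv_sym ARAS_ARef.
(* Three of the six equivalences are at hand; the other three pass through [hadamard ARAS ARAS]. *)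
do !split; apply: operad_equiv_isomorphic => //.
- exact: operad_equiv_trans DT_ARAS ARAS_ARef.
- exact: operad_equiv_trans DT_ARAS ARAS_RAS.
- exact: operad_equiv_trans ARef_ARAS ARAS_RAS.
Qed.
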